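(* For every integer $d\ge 0$, the following identities hold: (1) $H_d = \sum_{\delta \in \mathrm{PCom}_{\mathrm{sqf}}(d)} (-1)^{\ell(\delta)}E_\delta$; (2) $E_d = \sum_{\delta \in \mathrm{PCom}_{\mathrm{sqf}}(d)} (-1)^{\ell(\delta)}H_\delta$.
   Context: A composition of $n\ge 0$ is a finite tuple $\alpha=(\alpha_1,\dots,\alpha_k)$ of positive integers with sum $|\alpha|=n$; $\ell(\alpha)=k$; the empty composition is the only composition of $0$. A polycomposition of $n$ is a sequence $\delta=(\alpha^{(1)},\alpha^{(2)},\dots)$ of (possibly empty) compositions with $\sum_{i\ge1} i|\alpha^{(i)}|=n$; write $\delta|^i=\alpha^{(i)}$ and, formally (this is not exponentiation), $\delta=(\alpha^{(1)})^1(\alpha^{(2)})^2\cdots$, omitting empty compositions. Its length is $\ell(\delta)=\sum_i \ell(\delta|^i)$. Each part $d$ of $\delta|^r$ gives a block $d^r$ of $\delta$ (degree $d$, multiplicity $r$). $\mathrm{PCom}_{\mathrm{sqf}}(d)$ is the set of square-free polycompositions of $d$: those of the form $(\alpha)^1$ with $\alpha$ a composition of $d$ (all multiplicities equal to $1$). Let $x_{i,j}$ ($i,j\ge 1$) be indeterminates with $\deg x_{i,j}=i$; all series have rational coefficients. A monomial is square-free if every exponent is at most $1$. For $d\ge 0$: $H_d$ is the sum of all monomials of degree $d$; $E_d$ is the sum over square-free monomials $f$ of degree $d$ of $(-1)^{m(f)}f$, where $m(f)$ is the number of indeterminates in $f$. So $H_0=E_0=1$. For $F\in\{H,E\}$ and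 a block $d^r$, $F_{d^r}$ is obtained from $F_d$ by replacing each $x_{i,j}$ by $x_{i,j}^r$, and for a polycomposition $\delta$, $F_\delta=\prod F_{d^r}$ over all blocks $d^r$ of $\delta$ (counted with repetition; empty product $=1$). *)

(* Defs.v *)
From HB Require Import structures.
From mathcomp Require Import all_boot all_order all_algebra.
From mathcomp Require Import finmap.
From mathcomp Require Import mathcomp_extra boolp classical_sets functions.
From mathcomp Require Import cardinality fsbigop.
From mathcomp Require Import monalg.

Set Implicit Arguments.
Unset Strict Implicit.
Unset Printing Implicit Defensive.

Import GRing.Theory.

Local Open Scope classical_set_scope.
Local Open Scope fset_scope.
Local Open Scope ring_scope.

(* Formal power series over R in a possibly infinite family (x_i)_(i : I) of
   indeterminates: arbitrary families of coefficients indexed by monomials.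
   This is kept as a separate name because functions into R already carry the
   pointwise product. *)
Definition series (I : choiceType) (R : comNzRingType) : Type := {cmonom I} -> R.

HB.instance Definition _ (I : choiceType) (R : comNzRingType) :=
  GRing.Zmodule.copy (series I R) ({cmonom I} -> R).

Section SeriesRing.
Variables (I : choiceType) (R : comNzRingType).
Implicit Types (f g h : series I R) (m u v w : {cmonom I}).

Definition sone : series I R := fun m => (m == mone)%:R.

(* A monomial has finitely many factorizations (series_mulE below), so this is
   a genuine finite sum. *)
Definition smul f g : series I R := fun m =>
  \sum_(p \in [set p : {cmonom I} * {cmonom I} | mmul p.1 p.2 = m])
     f p.1 * g p.2.

Lemma finite_divisors m :
  exists D : {fset {cmonom I}}, forall u v, mmul u v = m -> u \in D /\ v \in D.
Proof.
pose N := mdeg m.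
pose mk (h : {ffun finsupp m -> 'I_N.+1}) : {cmonom I} :=
  mkcmonom [fsfun i : finsupp m => nat_of_ord (h i) | 0%N].
have le_deg i : (m i <= N)%N.
  rewrite /N mdegE; case: mdomP => // i_m.
  by rewrite (big_fsetD1 i) //= leq_addr.
have mkP u : (forall i, u i <= m i)%N ->
    u \in [fset x in [seq mk h | h : {ffun finsupp m -> 'I_N.+1}]].
  move=> le_um; rewrite in_fset /=; apply/mapP.
  exists [ffun i => inord (u (val i))]; first by rewrite mem_enum.
  apply/eqP/cmP => i; rewrite cmE fsfun_ffun; case: insubP => [j _ <-|im] /=.
    by rewrite ffunE inordK // ltnS (leq_trans (le_um _)).
  by have := le_um i; rewrite (fsfun_dflt im) leqn0 => /eqP.
exists [fset x in [seq mk h | h : {ffun finsupp m -> 'I_N.+1}]].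
by move=> u v uvm; split; apply: mkP => i; rewrite -uvm cmM ?leq_addr ?leq_addl.
Qed.

Lemma series_mulE f g m (D : {fset {cmonom I}}) :
    (forall u v, mmul u v = m -> u \in D /\ v \in D) ->
  smul f g m =
    \sum_(u <- D) \sum_(v <- D) (mmul u v == m)%:R * (f u * g v).
Proof.
move=> Dm; pose s := [seq (u, v) | u <- enum_fset D, v <- enum_fset D].
have s_uniq : uniq s.
  by rewrite allpairs_uniq ?fset_uniq // => -[? ?] [? ?] _ _ [-> ->].
rewrite /smul (@fsbigE _ _ _ _ _ [seq p <- s | mmul p.1 p.2 == m]).
- rewrite big_filter_cond big_mkcond big_allpairs /=.
  apply: eq_bigr => u _; apply: eq_bigr => v _.
  by case: eqP => [uvm|_]; rewrite ?mul0r // mem_set // mul1r.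
- exact: filter_uniq.
- by move=> p /=; rewrite mem_filter => /andP[/eqP].
move=> [u v] /= uvm; rewrite mem_filter /= uvm eqxx /=.
by have [uD vD] := Dm _ _ uvm; rewrite allpairs_f.
Qed.

Lemma smulC : commutative smul.
Proof.
move=> f g; apply: funext => m; have [D Dm] := finite_divisors m.
rewrite !(series_mulE _ _ Dm) exchange_big /=; apply: eq_bigr => u _.
by apply: eq_bigr => v _; rewrite mulmC [f _ * _]mulrC.
Qed.

Lemma smul1s : left_id sone smul.
Proof.
move=> f; apply: funext => m; have [D Dm] := finite_divisors m.
have [D1 mD] := Dm _ _ (mul1m m).
rewrite (series_mulE _ _ Dm) (big_fsetD1 mone D1) /=.
rewrite [X in _ + X]big_seq [X in _ + X]big1 ?addr0 => [|u]; last first.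
  move=> /fsetD1P[/negPf u1 _]; apply: big1 => v _.
  by rewrite /sone u1 mul0r mulr0.
rewrite (big_fsetD1 m mD) /= mul1m /sone !eqxx !mul1r.
rewrite [X in _ + X]big_seq [X in _ + X]big1 ?addr0 // => v /fsetD1P[/negPf vm _].
by rewrite mul1m vm mul0r.
Qed.

Lemma smulDl : left_distributive smul +%R.
Proof.
move=> f g h; apply: funext => m; have [D Dm] := finite_divisors m.
rewrite [RHS](_ : _ = smul f h m + smul g h m) // !(series_mulE _ _ Dm).
rewrite -big_split; apply: eq_bigr => u _; rewrite -big_split /=.
by apply: eq_bigr => v _; rewrite -mulrDr -mulrDl.
Qed.

Lemma smul3E f g h m (D : {fset {cmonom I}}) :
    (forall u v, mmul u v = m -> u \in D /\ v \in D) ->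
  smul f (smul g h) m = \sum_(u <- D) \sum_(v <- D) \sum_(w <- D)
    (mmul u (mmul v w) == m)%:R * (f u * g v * h w).
Proof.
move=> Dm; have Dl u w : u \in D -> (exists v, mmul u v = m) ->
    forall a b, mmul a b = u -> a \in D /\ b \in D.
  move=> uD [v uvm] a b abu; split.
    by have [] := Dm a (mmul b v); rewrite // mulmA abu.
  by have [] := Dm b (mmul a v); rewrite // mulmA [mmul b a]mulmC abu.
rewrite (series_mulE _ _ Dm); apply: eq_bigr => u _.
transitivity (\sum_(t <- D) \sum_(v <- D) \sum_(w <- D)
   (mmul u t == m)%:R * (mmul v w == t)%:R * (f u * g v * h w)).
  apply: eq_big_seq => t tD; have [utm|] := eqVneq (mmul u t) m; last first.
    move=> _; rewrite !mul0r big1 // => v _; rewrite big1 // => w _.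
    by rewrite !mul0r.
  rewrite (@series_mulE _ _ t D); last first.
    by apply: Dl => //; exists u; rewrite mulmC.
  rewrite mul1r big_distrr; apply: eq_bigr => v _.
  rewrite big_distrr; apply: eq_bigr => w _ /=.
  by rewrite mul1r mulrCA !mulrA.
rewrite exchange_big; apply: eq_bigr => v _.
rewrite exchange_big; apply: eq_bigr => w _ /=.
rewrite -big_distrl /=; congr (_ * _).
have [uvwm|neq] := eqVneq (mmul u (mmul v w)) m.
  have [_ vwD] := Dm _ _ uvwm.
  rewrite (big_fsetD1 _ vwD) /= uvwm !eqxx mul1r big_seq big1 ?addr0 //.
  by move=> t; rewrite !inE eq_sym => /andP[/negPf-> _]; rewrite mulr0.
rewrite big1 // => t _; have [<-|] := eqVneq (mmul v w) t.
  by rewrite (negPf neq) mul0r.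
by rewrite mulr0.
Qed.

Lemma smulA : associative smul.
Proof.
move=> f g h; apply: funext => m; have [D Dm] := finite_divisors m.
rewrite [smul f g]smulC [RHS](congr1 (@^~ m) (smulC _ _)) !(smul3E _ _ _ Dm).
under eq_bigr do rewrite exchange_big.
rewrite exchange_big /=; under eq_bigr do rewrite exchange_big.
apply: eq_bigr => w _; apply: eq_bigr => v _; apply: eq_bigr => u _.
rewrite mulmA [mmul (mmul u v) w]mulmC [mmul u v]mulmC.
by congr (_ * _); rewrite mulrC [f u * _]mulrC mulrA.
Qed.

Lemma sone_neq0 : sone != 0 :> series I R.
Proof.
apply/eqP => /(congr1 (@^~ mone)); rewrite /sone eqxx => /eqP.
by rewrite (_ : (0 : series I R) mone = 0) // oner_eq0.
Qed.

HB.instance Definition _ := GRing.Zmodule_isComNzRing.Build (series I R)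
  smulA smulC smul1s smulDl sone_neq0.

(* The series obtained from f by substituting x_i ^ r for every x_i.  For r > 0
   the map u |-> u ^ r is injective, so the sum has at most one term. *)
Definition series_pow (r : nat) f : series I R := fun m =>
  \sum_(u \in [set u : {cmonom I} | expcmn u r = m]) f u.

End SeriesRing.

Notation posnat := {n : nat | (0 < n)%N}.

Definition pone : posnat := exist _ 1%N isT.

Notation composition := (seq posnat).

Definition comp_size (a : composition) : nat := (\sum_(d <- a) val d)%N.

(* The polycomposition (a_1, a_2, ...), seen as the finitely supported function
   r |-> a_r whose default value is the empty composition. *)
Notation polycomp := {fsfun posnat -> composition with [::]}.

Definition polycomp_size (delta : polycomp) : nat :=
  (\sum_(r <- finsupp delta) val r * comp_size (delta r))%N.

Definition polycomp_length (delta : polycomp) : nat :=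
  (\sum_(r <- finsupp delta) size (delta r))%N.

(* The pair (d, r) is the block of degree d and multiplicity r. *)
Definition blocks (delta : polycomp) : seq (posnat * posnat) :=
  [seq (d, r) | r <- finsupp delta, d <- delta r].

Definition sqf_polycomp (a : composition) : polycomp :=
  [fsfun [fsfun] with pone |-> a].

Definition PCom_sqf (d : nat) : set polycomp :=
  [set sqf_polycomp a | a in [set a | comp_size a = d]].

(* The indeterminate x_(i, j), i, j >= 1, is indexed by the pair (i, j). *)
Notation indet := (posnat * posnat)%type.

Definition wdeg (m : {cmonom indet}) : nat :=
  (\sum_(x <- finsupp m) m x * val x.1)%N.

Definition sqfree_monom (m : {cmonom indet}) : bool :=
  all (fun x => m x <= 1)%N (finsupp m).

Definition Hser (d : nat) : series indet rat := fun m => (wdeg m == d)%:R.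

Definition Eser (d : nat) : series indet rat := fun m =>
  if sqfree_monom m && (wdeg m == d) then (-1) ^+ #|` finsupp m| else 0.

Definition polycomp_prod (F : nat -> series indet rat) (delta : polycomp) :
    series indet rat :=
  \prod_(b <- blocks delta) series_pow (val b.2) (F (val b.1)).

Lemma sqf_polycompE a r :
  sqf_polycomp a r = if r == pone then a else [::].
Proof. by rewrite fsfun_withE /=; case: ifP => _; rewrite ?fsfunE. Qed.

Lemma finsupp_sqf_polycomp a :
  finsupp (sqf_polycomp a) = if a == [::] then fset0 else [fset pone].
Proof.
apply/fsetP => r; rewrite mem_finsupp sqf_polycompE.
by case: (a =P [::]) => [->|/eqP a0]; rewrite ?in_fset0 ?in_fset1;
  case: (r =P pone); rewrite ?eqxx.
Qed.

Lemma sqf_polycomp_size a : polycomp_size (sqf_polycomp a) = comp_size a.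
Proof.
rewrite /polycomp_size finsupp_sqf_polycomp; case: eqP => [->|_].
  by rewrite big_seq_fset0 /comp_size big_nil.
by rewrite big_seq_fset1 sqf_polycompE eqxx mul1n.
Qed.

Lemma PCom_sqfE d : PCom_sqf d =
  [set delta | polycomp_size delta = d /\
               {in blocks delta, forall b, val b.2 = 1%N}].
Proof.
apply/seteqP; split=> [_ [a <- <-]|delta [<- sqf]] /=.
  split=> [|[d' r] /allpairsPdep[/= r' [d'' [rS _ [_ ->]]]]].
    exact: sqf_polycomp_size.
  move: rS; rewrite finsupp_sqf_polycomp.
  by case: (a =P [::]) => _; rewrite ?in_fset0 // in_fset1 => /eqP->.
suff deltaE : sqf_polycomp (delta pone) = delta.
  by exists (delta pone); rewrite //= -sqf_polycomp_size deltaE.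
apply/fsfunP => r; rewrite sqf_polycompE; case: eqP => [->//|/eqP r1].
case delta_r: (delta r) => [//|d' s]; case/eqP: r1; apply: val_inj.
apply: (sqf (d', r)); apply/allpairsPdep; exists r, d'.
by rewrite mem_finsupp delta_r mem_head.
Qed.

Lemma finite_PCom_sqf d : finite_set (PCom_sqf d).
Proof.
apply: finite_image; pose P := [set p : posnat | (val p <= d)%N].
have finP : finite_set P.
  apply: (@sub_finite_set _ _ [set insubd pone k | k in `I_d.+1]).
    by move=> p; rewrite /P /= -ltnS => pd; exists (val p); rewrite // valKd.
  exact: finite_image (finite_II _).
pose B n := [set a : composition | (size a <= n)%N /\ {in a, forall p, P p}].
have finB n : finite_set (B n).
  elim: n => [|n IHn].
    apply: (@sub_finite_set _ _ [set [::]]); last exact: finite_set1.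
    by move=> a [/=]; rewrite leqn0 => /nilP.
  apply: (@sub_finite_set _ _ ([set [::]] `|`
    [set q.1 :: q.2 | q in P `*` B n])).
    move=> [|p a] [/= an aP]; [by left | right; exists (p, a) => //].
    split=> /=; first by apply: aP; rewrite mem_head.
    by split=> // q qa; apply: aP; rewrite in_cons qa orbT.
  rewrite finite_setU; split; first exact: finite_set1.
  by apply: finite_image; apply: finite_setX.
apply: sub_finite_set (finB d) => a /= ad; split.
  rewrite -ad /comp_size -sum1_size; apply: leq_sum => p _; exact: valP p.
by move=> p pa; rewrite /P /= -ad /comp_size (big_rem p pa) leq_addr.
Qed.

(* Main.v *)
(* The identities say that (H_d) and (E_d) are inverse to each other for the
   convolution: sum_(i <= d) H_i E_(d - i) = [d = 0].  Indeed the coefficient of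
   a monomial m of degree d on the left is the sum of (-1)^#|S| over the subsets
   S of the support of m, since the square-free divisors of m are the products
   of distinct indeterminates of m.  The convolution inverse G of a sequence F
   with F_0 = 1 satisfies G_d = - sum_(0 < i <= d) F_i G_(d - i), which is also
   the recurrence, by removal of the first part, of the sum over compositions
   of d of the products of the - F_(a_i). *)
Require Import Defs.
From mathcomp Require Import all_boot all_order all_algebra.
From mathcomp Require Import finmap.
From mathcomp Require Import boolp classical_sets functions cardinality fsbigop.
From mathcomp Require Import monalg.

Set Implicit Arguments.
Unset Strict Implicit.
Unset Printing Implicit Defensive.

Import GRing.Theory.

Local Open Scope ring_scope.

(** * Compositions and inverses for the convolution of sequences *)

Definition posnatS (i : nat) : posnat := exist _ i.+1 isT.

(* [n] is fuel: the enumeration is complete as soon as [d <= n]. *)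
Fixpoint compositions (n d : nat) : seq composition :=
  if d is 0 then [:: [::]] else
  if n is n'.+1 then
    [seq posnatS i :: a | i <- iota 0 d, a <- compositions n' (d - i.+1)]
  else [::].

Lemma compositionsS n d : compositions n.+1 d.+1 =
  [seq posnatS i :: a | i <- iota 0 d.+1, a <- compositions n (d - i)].
Proof. by []. Qed.

Lemma compositions_uniq n d : uniq (compositions n d).
Proof.
elim: n d => [|n IHn] [|d] //; rewrite compositionsS.
apply: allpairs_uniq_dep => [|i _|]; [exact: iota_uniq | exact: IHn |].
by move=> [i a] [j b] _ _ /= [-> ->].
Qed.

Lemma mem_compositions n d a :
  (d <= n)%N -> (a \in compositions n d) = (comp_size a == d).
Proof.
elim: n d a => [|n IHn] [|d] // a dn; rewrite /comp_size.
- by case: a => [|[[|p] hp] a]; rewrite ?big_nil ?big_cons // inE.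
- by case: a => [|[[|p] hp] a]; rewrite ?big_nil ?big_cons // inE.
rewrite compositionsS; apply/allpairsPdep/eqP.
  move=> [i [b [+ + ->]]]; rewrite mem_iota add0n => id.
  rewrite IHn; last by rewrite (leq_trans (leq_subr _ _)).
  by move=> /eqP bE; rewrite big_cons -/(comp_size b) bE /= addSn subnKC.
case: a => [|[[|i] hi] a]; rewrite ?big_nil ?big_cons // -/(comp_size a).
rewrite [val _]/= addSn => -[adE]; exists i, a; split; last 1 first.
- by congr (_ :: _); apply: val_inj.
- by rewrite mem_iota ltnS -adE leq_addr.
by rewrite IHn -adE ?addKn // (leq_trans (leq_addl i _)) // adE.
Qed.

Section CompositionSum.
Variable A : comNzRingType.
Implicit Types F G : nat -> A.

(** Negating each factor absorbs the sign $(-1)^{\ell(a)}$, so that removing a first part needs no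
    separate treatment of signs. *)
Definition composition_sum F d : A :=
  \sum_(a \in [set a | comp_size a = d]%classic) \prod_(p <- a) - F (val p).

Lemma composition_sumE F n d : (d <= n)%N ->
  composition_sum F d = \sum_(a <- compositions n d) \prod_(p <- a) - F (val p).
Proof.
move=> dn; rewrite [RHS]fsbig_seq ?compositions_uniq //.
apply: eq_fsbigl; apply/seteqP; split=> a /=; rewrite mem_compositions //.
  by move/eqP.
by move/eqP.
Qed.

Lemma composition_sum0 F : composition_sum F 0%N = 1.
Proof. by rewrite (composition_sumE _ (leqnn 0)) big_seq1 big_nil. Qed.

Lemma composition_sumS F d : composition_sum F d.+1 =
  - \sum_(i < d.+1) F i.+1 * composition_sum F (d - i).
Proof.
rewrite (composition_sumE _ (leqnn _)) compositionsS big_allpairs_dep.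
rewrite -[iota 0 d.+1]/(index_iota 0 d.+1) big_mkord -sumrN.
(* The tails are enumerated with fuel [d], which is enough for [d - i]. *)
apply: eq_bigr => i _; rewrite (@composition_sumE F d) ?leq_subr //.
rewrite -mulNr big_distrr; apply: eq_bigr => a _.
by rewrite big_cons.
Qed.

Lemma composition_sum_inverse F G :
    (forall d, \sum_(i < d.+1) F i * G (d - i)%N = (d == 0%N)%:R) ->
    F 0%N = 1 ->
  forall d, G d = composition_sum F d.
Proof.
move=> FG F0 d; have [n] := ubnP d; elim: n d => // n IHn [|d] dn.
  by have := FG 0%N; rewrite big_ord1 /= F0 mul1r composition_sum0.
rewrite composition_sumS; apply/eqP; rewrite -addr_eq0; apply/eqP.
(* The term of index 0 is [G d.+1]; by induction the others are those of the recurrence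
   [composition_sumS]. *)
apply: etrans (FG d.+1); rewrite [RHS]big_ord_recl F0 mul1r.
congr (_ + _); apply: eq_bigr => i _ /=; rewrite subSS IHn //.
by rewrite (leq_ltn_trans (leq_subr _ _)).
Qed.

End CompositionSum.

(** Expand the product over [T] of $(-1) + 1$: each subset selects the factors that contribute
    $-1$. *)
Lemma sum_signed_subsets (R : comNzRingType) (T : finType) :
  \sum_(S : {set T}) (-1) ^+ #|S| = (#|T| == 0%N)%:R :> R.
Proof.
have := bigA_distr 1 +%R (fun=> -1 : R) (fun=> 1 : R) (I := T).
rewrite /= prodr_const addNr expr0n => ->; apply: eq_bigr => S _.
by rewrite -big_mkcond prodr_const.
Qed.

(** * Square-free divisors of a monomial *)

Section SquareFreeDivisors.
Variable m : {cmonom indet}.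

Definition set_monom (S : {set finsupp m}) : {cmonom indet} :=
  mkcmonom [fsfun x : finsupp m => nat_of_bool (x \in S) | 0%N].

Lemma set_monomE S (x : finsupp m) : set_monom S (val x) = (x \in S).
Proof.
rewrite cmE fsfun_ffun; case: insubP => [y _ /val_inj->//|].
by rewrite (valP x).
Qed.

Lemma set_monom_dflt S i : i \notin finsupp m -> set_monom S i = 0%N.
Proof. by move=> im; rewrite cmE fsfun_ffun insubN. Qed.

Lemma set_monom_inj : injective set_monom.
Proof.
move=> S S' /(congr1 (fun v : {cmonom indet} => v : indet -> nat)) eqv.
apply/setP => x; have := congr1 (@^~ (val x)) eqv; rewrite /= !set_monomE.
by do 2!case: (_ \in _).
Qed.

Lemma set_monom_le S i : (set_monom S i <= m i)%N.
Proof.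
have [im|im] := boolP (i \in finsupp m); last by rewrite set_monom_dflt.
rewrite -[i]/(val [` im]%fset) set_monomE (leq_trans (leq_b1 _)) //.
by rewrite lt0n cmE_neq0.
Qed.

Lemma mul_divcm_set_monom S : mmul (divcm m (set_monom S)) (set_monom S) = m.
Proof.
by apply/eqP/cmP => i; rewrite cmM divcmE subnK // set_monom_le.
Qed.

Lemma finsupp_set_monom S :
  finsupp (set_monom S) = [fset val x | x in S]%fset.
Proof.
apply/fsetP => i; rewrite -cmE_neq0; apply/idP/imfsetP => /= [|[x xS ->]].
  have [im|im] := boolP (i \in finsupp m); last by rewrite set_monom_dflt.
  by rewrite -[i]/(val [` im]%fset) set_monomE eqb0 negbK; exists [` im]%fset.
by rewrite set_monomE xS.
Qed.

Lemma card_finsupp_set_monom S : #|` finsupp (set_monom S)| = #|S|.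
Proof. by rewrite finsupp_set_monom card_imfset ?cardE //; apply: val_inj. Qed.

Lemma sqfree_set_monom S : sqfree_monom (set_monom S).
Proof.
apply/allP => i _; have [im|im] := boolP (i \in finsupp m).
  by rewrite -[i]/(val [` im]%fset) set_monomE leq_b1.
by rewrite set_monom_dflt.
Qed.

(** The exponents of [v] are 0 or 1 and its support lies in that of [m], so [v] is determined by the
    set where it is 1; then [u] follows by cancellation. *)
Lemma sqfree_divisorP u v : mmul u v = m -> sqfree_monom v ->
  exists S, (u, v) = (divcm m (set_monom S), set_monom S).
Proof.
move=> uvm /allP v1; pose S := [set x : finsupp m | v (val x) == 1%N].
have vE : v = set_monom S.
  apply/eqP/cmP => i; have [im|im] := boolP (i \in finsupp m).
    rewrite -[i in RHS]/(val [` im]%fset) set_monomE inE /=.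
    have [/v1|/fsfun_dflt->//] := boolP (i \in finsupp v).
    by case: (v i) => [|[|]].
  rewrite set_monom_dflt //; apply/eqP; move: im.
  by rewrite -cmE_eq0 -uvm cmM addn_eq0 => /andP[].
exists S; rewrite -vE; congr (_, _).
by apply/eqP/cmP => i; rewrite divcmE -uvm cmM addnK.
Qed.

(** Only factorizations with a square-free second factor contribute, and these correspond
    bijectively to the subsets of the support of [m]. *)
Lemma series_mul_sqfree (f g : series indet rat) :
    (forall v, ~~ sqfree_monom v -> g v = 0) ->
  (f * g) m = \sum_(S : {set finsupp m})
                 f (divcm m (set_monom S)) * g (set_monom S).
Proof.
move=> g0; pose h S := (divcm m (set_monom S), set_monom S).
rewrite [LHS](fsbigE [seq h J | J : {set finsupp m}]).
- rewrite big_image_cond big_mkcond; apply: eq_bigr => S _.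
  by rewrite mem_set //= mul_divcm_set_monom.
- by rewrite map_inj_uniq ?enum_uniq // => S S' [_ /set_monom_inj].
- by move=> _ /mapP[S _ ->] /=; exact: mul_divcm_set_monom.
move=> [u v] /= uvm; apply: contraNeq => fg.
have [|v1] := boolP (sqfree_monom v); last by rewrite g0 ?mulr0 ?eqxx in fg.
by move=> /(sqfree_divisorP uvm)[S ->]; rewrite map_f ?mem_enum.
Qed.

End SquareFreeDivisors.

(** * Weighted degree and the convolution identity *)

Lemma wdegM (u v : {cmonom indet}) : wdeg (mmul u v) = (wdeg u + wdeg v)%N.
Proof.
(* Zero exponents add nothing, so both degrees can be summed over the union of the two supports. *)
have wdegEw (w : {cmonom indet}) (D : {fset indet}) : (finsupp w `<=` D)%fset ->
    wdeg w = (\sum_(x <- D) w x * val x.1)%N.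
  move=> wD; rewrite /wdeg (big_fset_incl _ wD) // => x _ xw.
  by rewrite fsfun_dflt.
rewrite (wdegEw u _ (fsubsetUl _ (finsupp v))).
rewrite (wdegEw v _ (fsubsetUr (finsupp u) _)) /wdeg mdomD -big_split.
by apply: eq_bigr => x _; rewrite cmM mulnDl.
Qed.

Lemma finsupp_eq0 (m : {cmonom indet}) :
  (finsupp m == fset0) = (m == mone).
Proof.
apply/eqP/eqP => [m0|->]; last exact: mdom1.
by apply/eqP/cmP => x; rewrite cm1 fsfun_dflt // m0 in_fset0.
Qed.

Lemma wdeg_eq0 m : (wdeg m == 0)%N = (m == mone).
Proof.
rewrite -finsupp_eq0; apply/eqP/eqP => [m0|m0]; last first.
  by rewrite /wdeg m0 big_seq_fset0.
apply/fsetP => x; rewrite in_fset0; apply/negP => xm; move: m0.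
rewrite /wdeg (big_fsetD1 _ xm) => /eqP.
by rewrite addn_eq0 muln_eq0 cmE_eq0 xm eqn0Ngt (valP x.1).
Qed.

Lemma Eser_nonsqfree d m : ~~ sqfree_monom m -> Eser d m = 0.
Proof. by rewrite /Eser => /negPf->. Qed.

Lemma Hser0 : Hser 0%N = 1.
Proof. by apply: funext => m; rewrite /Hser wdeg_eq0. Qed.

Lemma Eser0 : Eser 0%N = 1.
Proof.
apply: funext => m; rewrite /Eser wdeg_eq0 [RHS]/(_ %:R).
have [->|] := eqVneq; last by rewrite andbF.
by rewrite /sqfree_monom mdom1.
Qed.

Lemma sum_Hser_Eser d :
  \sum_(i < d.+1) Hser i * Eser (d - i)%N = (d == 0%N)%:R.
Proof.
apply: funext => m.
have -> : (\sum_(i < d.+1) Hser i * Eser (d - i)%N) m =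
    \sum_(i < d.+1) (Hser i * Eser (d - i)%N) m.
  exact: (big_morph (fun f : series indet rat => f m)).
under eq_bigr do rewrite (series_mul_sqfree m _ (@Eser_nonsqfree _)).
rewrite exchange_big /=.
transitivity ((wdeg m == d)%:R * \sum_(S : {set finsupp m}) (-1) ^+ #|S| : rat).
  rewrite big_distrr; apply: eq_bigr => S _ /=.
  have := wdegM (divcm m (set_monom S)) (set_monom S).
  rewrite mul_divcm_set_monom /Hser /Eser => ->.
  rewrite sqfree_set_monom card_finsupp_set_monom /=.
  (* Here [b] is the degree of [set_monom S] and [a] that of its cofactor. Only [i = a] contributes,
     and as [i <= d] the subtraction is not truncated: [b = d - i] means [i + b = d]. *)
  move: (wdeg _) (wdeg _) => b a.
  rewrite (eq_bigr (fun i : 'I_d.+1 => if i == a :> nat then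
      if (a + b == d)%N then (-1) ^+ #|S| else 0 else 0)) => [|i _].
    rewrite -big_mkcond; have [abd|abd] := eqVneq (a + b)%N d; last first.
      by rewrite big1 ?mul0r.
    have ad : (a < d.+1)%N by rewrite ltnS -abd leq_addr.
    by rewrite (big_pred1 (Ordinal ad)) ?mul1r.
  rewrite eq_sym; have [->|_] := eqVneq a i; last by rewrite mul0r.
  by rewrite mul1r -(eqn_add2l i) subnKC // -ltnS.
(* The signed sum vanishes unless [m] is 1, whose degree is 0. *)
rewrite sum_signed_subsets -cardfE cardfs_eq0 finsupp_eq0.
have -> : ((d == 0%N)%:R : series indet rat) m = ((d == 0%N) && (m == mone))%:R.
  by case: eqP.
rewrite -natrM mulnb; congr (nat_of_bool _)%:R.
have [->|_] := eqVneq m mone; last by rewrite !andbF.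
by rewrite !andbT /wdeg mdom1 big_seq_fset0 eq_sym.
Qed.

(** * From square-free polycompositions to compositions *)

Lemma series_pow1 (f : series indet rat) : series_pow 1 f = f.
Proof. by apply: funext => m; rewrite /series_pow fsbig_set1. Qed.

Lemma sqf_polycomp_length a : polycomp_length (sqf_polycomp a) = size a.
Proof.
rewrite /polycomp_length finsupp_sqf_polycomp; case: eqP => [->|_].
  by rewrite big_seq_fset0.
by rewrite big_seq_fset1 sqf_polycompE eqxx.
Qed.

Lemma polycomp_prod_sqf F a :
  polycomp_prod F (sqf_polycomp a) = \prod_(p <- a) F (val p).
Proof.
rewrite /polycomp_prod /blocks big_allpairs_dep finsupp_sqf_polycomp.
case: eqP => [->|_]; first by rewrite big_seq_fset0 big_nil.
rewrite big_seq_fset1 sqf_polycompE eqxx; apply: eq_bigr => p _.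
exact: series_pow1.
Qed.

(** Since [a] is the value of [sqf_polycomp a] at [pone], the sum can be reindexed by compositions;
    the sign then gives one factor $-1$ per part. *)
Lemma sum_PCom_sqf F d :
  \sum_(delta \in PCom_sqf d)
    (-1) ^+ polycomp_length delta * polycomp_prod F delta =
  composition_sum F d.
Proof.
rewrite /PCom_sqf fsbig_image; last first.
  move=> a b _ _ /(congr1 (fun delta : polycomp => delta pone)).
  by rewrite !sqf_polycompE.
apply: eq_fsbigr => a _; rewrite polycomp_prod_sqf sqf_polycomp_length.
elim: a => [|p a IHa]; first by rewrite !big_nil mulr1.
by rewrite !big_cons /= exprS mulrACA IHa mulN1r.
Qed.

Theorem proposition11 (d : nat) :
  (Hser d = \sum_(delta \in PCom_sqf d)
              (-1) ^+ polycomp_length delta * polycomp_prod Eser delta)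
  /\
  (Eser d = \sum_(delta \in PCom_sqf d)
              (-1) ^+ polycomp_length delta * polycomp_prod Hser delta).
Proof.
rewrite !sum_PCom_sqf; split; last first.
  exact: composition_sum_inverse sum_Hser_Eser Hser0 d.
apply: composition_sum_inverse Eser0 d => d.
(* Reversing the summation exchanges the roles of $H$ and $E$, by commutativity. *)
rewrite -sum_Hser_Eser (reindex_inj rev_ord_inj).
by apply: eq_bigr => i _ /=; rewrite subSS mulrC subKn // -ltnS.
Qed.
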